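(* Let $n\geq 3$ be even. There does not exist a linear map $\chi_n\colon\mathbb{C}[\mathsf{S}_n]\to\mathbb{C}[\mathsf{S}_{n+1}]$ mapping length-one elements to length-one elements and such that there is a Hopf algebra morphism $\zeta_n\colon\mathrm{C}(\mathbb{G}_n)\to\mathrm{C}(\mathbb{G}_{n+1})$ with $$\alpha_{n+1}\circ\chi_n=(\chi_n\otimes\zeta_n)\circ\alpha_n .$$
   Context: For $n\in\mathbb{N}$ let $\mathsf{S}_n$ be the symmetric group with generating set of nearest-neighbour transpositions $s^{(n)}_1,\dots,s^{(n)}_{n-1}$. A length-one element of $\mathbb{C}[\mathsf{S}_n]$ is a nontrivial (i.e. nonzero) linear combination of $s^{(n)}_1,\dots,s^{(n)}_{n-1}$. Let $\theta_n$ be the automorphism of $\mathsf{S}_n$ with $\theta_n(s^{(n)}_i)=s^{(n)}_{n-i}$, extended linearly to the Hopf $*$-algebra $\mathbb{C}[\mathsf{S}_n]$, whose comultiplication $\Delta_{\mathbb{C}[\mathsf{S}_n]}$ is given by $\gamma\mapsto\gamma\otimes\gamma$ for $\gamma\in\mathsf{S}_n$. $\mathrm{C}(\mathbb{G}_n)$ is the finite-dimensional Hopf $*$-algebra which as a $*$-algebra equals $\mathbb{C}[\mathsf{S}_n]\oplus\mathbb{C}[\mathsf{S}_n]$, with comultiplication $\Delta_n$ determined, with $\xi_n(a)=(a,0)$ and $\eta_n(a)=(0,a)$, by $$\Delta_n\circ\xi_n=\bigl(\xi_n\otimes\xi_n+\eta_n\otimes(\eta_n\circ\theta_n)\bigr)\circ\Delta_{\mathbb{C}[\mathsf{S}_n]},\qquad\Delta_n\circ\eta_n=\bigl(\xi_n\otimes\eta_n+\eta_n\otimes(\xi_n\circ\theta_n)\bigr)\circ\Delta_{\mathbb{C}[\mathsf{S}_n]}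 .$$ (For $n\ge3$ the corresponding compact quantum group $\mathbb{G}_n$ is the quantum isometry group of $\widehat{\mathsf{S}_n}$.) Its canonical coaction $\alpha_n\colon\mathbb{C}[\mathsf{S}_n]\to\mathbb{C}[\mathsf{S}_n]\otimes\mathrm{C}(\mathbb{G}_n)$ is $$\alpha_n=\bigl(\mathrm{id}\otimes\xi_n+\theta_n\otimes(\eta_n\circ\theta_n)\bigr)\circ\Delta_{\mathbb{C}[\mathsf{S}_n]},\quad\text{i.e. }\ \alpha_n(\gamma)=\gamma\otimes(\gamma,0)+\theta_n(\gamma)\otimes(0,\theta_n(\gamma)),\ \gamma\in\mathsf{S}_n .$$ *)

(* Defs.v *)
From HB Require Import structures.
From mathcomp Require Import all_boot all_order all_fingroup all_algebra.
From mathcomp Require Export reals complex.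

Set Implicit Arguments.
Unset Strict Implicit.
Unset Printing Implicit Defensive.

Import GRing.Theory.
Local Open Scope ring_scope.

(* The tensor product of two finite-dimensional spaces with their library bases
   (b_i) and (c_j): the matrix t stands for \sum_(i, j) t i j (b_i (x) c_j). *)
Notation tensor U V := 'M_(\dim (fullv : {vspace U}), \dim (fullv : {vspace V})).

Section Tensor.
Variable F : fieldType.

Definition tens (U V : vectType F) (u : U) (v : V) : tensor U V :=
  \matrix_(i, j) (coord (vbasis fullv) i u * coord (vbasis fullv) j v).

Definition tensmap (U V U' V' : vectType F)
    (f : {linear U -> U'}) (g : {linear V -> V'}) (t : tensor U V) :
    tensor U' V' :=
  \sum_i \sum_j t i j *: tens (f (vbasis fullv)`_i) (g (vbasis fullv)`_j).

Lemma tens_linear_l (U V : vectType F) (v : V) :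
  linear (fun u : U => tens u v).
Proof.
by move=> k u u'; apply/matrixP => i j; rewrite !mxE linearP mulrDl mulrA.
Qed.

Lemma tens_linear_r (U V : vectType F) (u : U) : linear (@tens U V u).
Proof.
by move=> k v v'; apply/matrixP => i j; rewrite !mxE linearP mulrDr mulrCA.
Qed.

Lemma tensmap_linear (U V U' V' : vectType F)
  (f : {linear U -> U'}) (g : {linear V -> V'}) : linear (tensmap f g).
Proof.
move=> k t t'; rewrite /tensmap scaler_sumr -big_split /=.
apply: eq_bigr => i _; rewrite scaler_sumr -big_split /=.
by apply: eq_bigr => j _; rewrite !mxE scalerDl scalerA.
Qed.

HB.instance Definition _ (U V U' V' : vectType F)
    (f : {linear U -> U'}) (g : {linear V -> V'}) :=
  GRing.isLinear.Build F (tensor U V) (tensor U' V') _ (tensmap f g)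
    (tensmap_linear f g).

Lemma tensmapE (U V U' V' : vectType F)
    (f : {linear U -> U'}) (g : {linear V -> V'}) (u : U) (v : V) :
  tensmap f g (tens u v) = tens (f u) (g v).
Proof.
rewrite [in RHS](coord_vbasis (memvf u)) [in RHS](coord_vbasis (memvf v)).
apply/matrixP => k l; rewrite !mxE !linear_sum /= mulr_suml summxE.
apply: eq_bigr => i _; rewrite mulr_sumr summxE; apply: eq_bigr => j _.
by rewrite !linearZ !mxE /= mulrACA.
Qed.

End Tensor.

(* The group algebra F[G]: functions G -> F with the convolution product. *)
Section GroupAlgebra.
Variables (F : fieldType) (gT : finGroupType).

Definition galg : Type := {ffun gT -> F^o}.
HB.instance Definition _ := Vector.copy galg {ffun gT -> F^o}.

Definition gelt (g : gT) : galg := [ffun x => (x == g)%:R].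
Definition galg_mul (a b : galg) : galg :=
  [ffun x => \sum_y a y * b (y^-1 * x)%g].

Lemma galg_mulA : associative galg_mul.
Proof.
move=> a b c; apply/ffunP => x; rewrite !ffunE.
under eq_bigr do rewrite ffunE mulr_sumr.
under [RHS]eq_bigr do rewrite ffunE mulr_suml.
rewrite [RHS]exchange_big /=; apply: eq_bigr => y _.
rewrite [RHS](reindex_inj (mulgI y)) /=; apply: eq_bigr => z _.
by rewrite mulrA invMg mulKg mulgA.
Qed.
Lemma galg_mul1l : left_id (gelt 1%g) galg_mul.
Proof.
move=> a; apply/ffunP => x; rewrite ffunE (bigD1 1%g) //= ffunE eqxx mul1r.
rewrite big1 ?addr0 ?invg1 ?mul1g // => y /negPf y1.
by rewrite ffunE y1 mul0r.
Qed.
Lemma galg_mul1r : right_id (gelt 1%g) galg_mul.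
Proof.
move=> a; apply/ffunP => x; rewrite ffunE (bigD1 x) //= ffunE mulVg eqxx mulr1.
rewrite big1 ?addr0 // => y yx; rewrite ffunE -eq_mulVg1.
by rewrite (negPf yx) mulr0.
Qed.
Lemma galg_mulDl : left_distributive galg_mul +%R.
Proof.
move=> a b c; apply/ffunP => x; rewrite !ffunE -big_split /=.
by apply: eq_bigr => y _; rewrite ffunE mulrDl.
Qed.
Lemma galg_mulDr : right_distributive galg_mul +%R.
Proof.
move=> a b c; apply/ffunP => x; rewrite !ffunE -big_split /=.
by apply: eq_bigr => y _; rewrite ffunE mulrDr.
Qed.
Lemma galg_1_neq0 : gelt 1%g != 0.
Proof. by apply/eqP => /ffunP/(_ 1%g)/eqP; rewrite !ffunE eqxx oner_eq0. Qed.

HB.instance Definition _ := GRing.Zmodule_isNzRing.Build galg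
  galg_mulA galg_mul1l galg_mul1r galg_mulDl galg_mulDr galg_1_neq0.

Lemma galg_scaleAl (k : F) (a b : galg) : k *: (a * b) = (k *: a) * b.
Proof.
apply/ffunP => x; rewrite !ffunE scaler_sumr; apply: eq_bigr => y _.
by rewrite ffunE scalerAl.
Qed.
HB.instance Definition _ := GRing.Lmodule_isLalgebra.Build F galg galg_scaleAl.

Lemma galg_scaleAr (k : F) (a b : galg) : k *: (a * b) = a * (k *: b).
Proof.
apply/ffunP => x; rewrite !ffunE scaler_sumr; apply: eq_bigr => y _.
by rewrite ffunE; apply: mulrCA.
Qed.
HB.instance Definition _ := GRing.Lalgebra_isAlgebra.Build F galg galg_scaleAr.

Lemma geltM (g h : gT) : gelt (g * h)%g = gelt g * gelt h.
Proof.
apply/ffunP => x; rewrite !ffunE (bigD1 g) //= !ffunE eqxx mul1r.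
rewrite big1 ?addr0; first by rewrite -(inj_eq (mulgI g^-1)%g) mulKg.
by move=> y /negPf yg; rewrite ffunE yg mul0r.
Qed.

(* The linear extension to F[G] of a map defined on G. *)
Definition gext (V : lmodType F) (f : gT -> V) (a : galg) : V :=
  \sum_g (a g : F) *: f g.

Lemma gext_linear (V : lmodType F) (f : gT -> V) : linear (gext f).
Proof.
move=> k a b; rewrite /gext scaler_sumr -big_split /=; apply: eq_bigr => g _.
by rewrite !ffunE scalerDl scalerA.
Qed.
HB.instance Definition _ (V : lmodType F) (f : gT -> V) :=
  GRing.isLinear.Build F galg V _ (gext f) (gext_linear f).

Lemma gext_gelt (V : lmodType F) (f : gT -> V) (g : gT) : gext f (gelt g) = f g.
Proof.
rewrite /gext (bigD1 g) //= ffunE eqxx scale1r big1 ?addr0 // => h /negPf hg.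
by rewrite ffunE hg scale0r.
Qed.

Lemma galg_expand (a : galg) : a = gext gelt a.
Proof.
apply/ffunP => x; rewrite /gext sum_ffunE (bigD1 x) //= !ffunE eqxx.
rewrite [_ *: _]mulr1 big1 ?addr0 // => g /negPf gx.
by rewrite !ffunE eq_sym gx scaler0.
Qed.

Lemma galg_ext (V : lmodType F) (f h : {linear galg -> V}) :
  (forall g, f (gelt g) = h (gelt g)) -> f =1 h.
Proof.
move=> fh a; rewrite [a]galg_expand /gext !linear_sum.
by apply: eq_bigr => g _; rewrite !linearZ fh.
Qed.

Definition gcomul : galg -> tensor galg galg :=
  gext (fun g => tens (gelt g) (gelt g)).
HB.instance Definition _ := GRing.Linear.on gcomul.

Lemma gcomul_gelt (g : gT) : gcomul (gelt g) = tens (gelt g) (gelt g).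
Proof. exact: gext_gelt. Qed.

Definition gcounit : galg -> F^o := gext (fun=> 1 : F^o).
HB.instance Definition _ := GRing.Linear.on gcounit.

End GroupAlgebra.

Arguments gelt F {gT} g.

Section Transpositions.
Variable n : nat.

Lemma transp_subproof (i : 'I_n.-1) : (i.+1 < n)%N.
Proof. by rewrite -ltn_predRL. Qed.

(* Indices start from 0: transp i, for i < n - 1, exchanges i and i + 1 and is
   the generator s_(i + 1). *)
Definition transp (i : 'I_n.-1) : 'S_n :=
  tperm (Ordinal (ltnW (transp_subproof i))) (Ordinal (transp_subproof i)).

(* Conjugation by the order-reversing permutation; since the transp i generate
   'S_n, theta_transp characterises it among the automorphisms of 'S_n. *)
Definition theta (g : 'S_n) : 'S_n := (g ^ perm (@rev_ord_inj n))%g.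

Lemma thetaM : {morph theta : g h / (g * h)%g}.
Proof. by move=> g h; apply: conjMg. Qed.

Lemma thetaK : involutive theta.
Proof.
move=> g; rewrite /theta -conjgM (_ : _ * _ = 1)%g ?conjg1 //.
by apply/permP => i; rewrite permM !permE rev_ordK.
Qed.

Lemma theta_transp (i : 'I_n.-1) : theta (transp i) = transp (rev_ord i).
Proof.
rewrite /theta /transp tpermJ !permE tpermC.
by congr (tperm _ _); apply: val_inj => /=; case: i => i /=; case: n => // m;
   rewrite /= ?subSS // => im; rewrite subnSK.
Qed.

End Transpositions.

(* C[S_n] and C(G_n); the library's product of two algebras is their direct
   sum. *)
Notation CS F n := (galg F 'S_n).
Notation CG F n := (galg F 'S_n * galg F 'S_n)%type.

Section QuantumGroup.
Variables (F : fieldType) (n : nat).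

Definition length_one (a : CS F n) : Prop :=
  a != 0 /\ exists c : 'I_n.-1 -> F, a = \sum_i c i *: gelt F (transp i).

Definition Theta : CS F n -> CS F n := gext (fun g => gelt F (theta g)).
HB.instance Definition _ := GRing.Linear.on Theta.

Lemma Theta_gelt (g : 'S_n) : Theta (gelt F g) = gelt F (theta g).
Proof. exact: gext_gelt. Qed.

Definition xi (a : CS F n) : CG F n := (a, 0).
Definition eta (a : CS F n) : CG F n := (0, a).

Lemma xi_linear : linear xi.
Proof. by move=> k a b; congr (_, _); rewrite /= scaler0 addr0. Qed.
HB.instance Definition _ := GRing.isLinear.Build F _ _ _ xi xi_linear.
Lemma eta_linear : linear eta.
Proof. by move=> k a b; congr (_, _); rewrite /= scaler0 addr0. Qed.
HB.instance Definition _ := GRing.isLinear.Build F _ _ _ eta eta_linear.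

Definition comul (x : CG F n) : tensor (CG F n) (CG F n) :=
  (tensmap xi xi (gcomul x.1) + tensmap eta (eta \o Theta) (gcomul x.1))
  + (tensmap xi eta (gcomul x.2) + tensmap eta (xi \o Theta) (gcomul x.2)).

(* The counit is determined by comul: see counit_comul_l and counit_comul_r. *)
Definition counit (x : CG F n) : F^o := gcounit x.1.

Definition coaction (a : CS F n) : tensor (CS F n) (CG F n) :=
  tensmap idfun xi (gcomul a) + tensmap Theta (eta \o Theta) (gcomul a).

Lemma comul_xi (a : CS F n) :
  comul (xi a) =
  tensmap xi xi (gcomul a) + tensmap eta (eta \o Theta) (gcomul a).
Proof. by rewrite /comul /= !linear0 !addr0. Qed.

Lemma comul_eta (a : CS F n) :
  comul (eta a) =
  tensmap xi eta (gcomul a) + tensmap eta (xi \o Theta) (gcomul a).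
Proof. by rewrite /comul /= !linear0 !add0r. Qed.

Lemma coaction_gelt (g : 'S_n) :
  coaction (gelt F g) =
  tens (gelt F g) (xi (gelt F g))
  + tens (gelt F (theta g)) (eta (gelt F (theta g))).
Proof. by rewrite /coaction gcomul_gelt !tensmapE /= Theta_gelt. Qed.

Lemma comul_linear : linear comul.
Proof.
move=> k x y; rewrite /comul /= !linearP /= !scalerDr.
by rewrite !(addrACA (_ *: _) (tensmap _ _ _)) (addrACA (_ + _)). 
Qed.
HB.instance Definition _ := GRing.isLinear.Build F _ _ _ comul comul_linear.

Lemma counit_linear : linear counit.
Proof. by move=> k x y; rewrite /counit /= linearP. Qed.
HB.instance Definition _ := GRing.isLinear.Build F _ _ _ counit counit_linear.

Lemma CG_ext (V : lmodType F) (f h : {linear CG F n -> V}) :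
  (forall g, f (xi (gelt F g)) = h (xi (gelt F g))) ->
  (forall g, f (eta (gelt F g)) = h (eta (gelt F g))) -> f =1 h.
Proof.
move=> fhx fhe [a b]; have -> : (a, b) = xi a + eta b.
  by congr (_, _); rewrite /= ?addr0 ?add0r.
rewrite !linearD; congr (_ + _).
  exact: (galg_ext (f := f \o xi) (h := h \o xi)).
exact: (galg_ext (f := f \o eta) (h := h \o eta)).
Qed.

Lemma counit_xi (g : 'S_n) : counit (xi (gelt F g)) = 1.
Proof. by rewrite /counit /= /gcounit gext_gelt. Qed.

Lemma counit_eta (a : CS F n) : counit (eta a) = 0.
Proof. by rewrite /counit /= linear0. Qed.

Lemma comul_xi_gelt (g : 'S_n) :
  comul (xi (gelt F g)) = tens (xi (gelt F g)) (xi (gelt F g))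
    + tens (eta (gelt F g)) (eta (gelt F (theta g))).
Proof. by rewrite comul_xi gcomul_gelt !tensmapE /= Theta_gelt. Qed.

Lemma comul_eta_gelt (g : 'S_n) :
  comul (eta (gelt F g)) = tens (xi (gelt F g)) (eta (gelt F g))
    + tens (eta (gelt F g)) (xi (gelt F (theta g))).
Proof. by rewrite comul_eta gcomul_gelt !tensmapE /= Theta_gelt. Qed.

Lemma counit_comul_l (x : CG F n) :
  tensmap counit idfun (comul x) = tens (1 : F^o) x.
Proof.
pose l := GRing.isLinear.Build F _ _ _ _ (tens_linear_r (V := CG F n) (1 : F^o)).
pose L : {linear CG F n -> _} := HB.pack (tens (1 : F^o)) l.
have tens0l (v : CG F n) : tens (0 : F^o) v = 0.
  by apply/matrixP => i j; rewrite !mxE linear0 mul0r.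
apply: (CG_ext (f := tensmap counit idfun \o comul) (h := L)) => g /=.
  rewrite comul_xi_gelt linearD /= !tensmapE /=.
  by rewrite counit_xi counit_eta tens0l addr0.
rewrite comul_eta_gelt linearD /= !tensmapE /=.
by rewrite counit_xi counit_eta tens0l addr0.
Qed.

Lemma counit_comul_r (x : CG F n) :
  tensmap idfun counit (comul x) = tens x (1 : F^o).
Proof.
pose l := GRing.isLinear.Build F _ _ _ _ (tens_linear_l (U := CG F n) (1 : F^o)).
pose L : {linear CG F n -> _} := HB.pack (fun y => tens y (1 : F^o)) l.
have tens0r (v : CG F n) : tens v (0 : F^o) = 0.
  by apply/matrixP => i j; rewrite !mxE linear0 mulr0.
apply: (CG_ext (f := tensmap idfun counit \o comul) (h := L)) => g /=.
  rewrite comul_xi_gelt linearD /= !tensmapE /=.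
  by rewrite counit_xi counit_eta tens0r addr0.
rewrite comul_eta_gelt linearD /= !tensmapE /=.
by rewrite counit_xi counit_eta tens0r add0r.
Qed.

End QuantumGroup.

(* A {lrmorphism _ -> _} is a unital algebra homomorphism. Compatibility with
   the antipodes is automatic; preservation of the involution is not required. *)
Definition hopf_morphism (F : fieldType) (m n : nat)
    (f : {lrmorphism CG F m -> CG F n}) : Prop :=
  (forall x, comul (f x) = tensmap f f (comul x)) /\
  (forall x, counit (f x) = counit x).

(* Main.v *)
From HB Require Import structures.
Require Import Defs.
From mathcomp Require Import all_boot all_order all_fingroup all_algebra.
From mathcomp Require Import zify.

(** For [n] even, the middle generator [s] of ['S_n] is fixed by [theta], so
    intertwining at [s] reads [coaction (chi s) = tens (chi s) u] with
    [u = zeta (s, s)] and [u * u = 1]. Comparing the coefficients of a generator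
    [h] of ['S_n.+1] gives [(c h * h, c (theta h) * h) = c h * u], where [c h] is
    the coefficient of [h] in [chi s]. If [c h != 0], then [u] has first component
    [h]; its second component is nonzero, so [c (theta h) != 0] and the first
    component of [u] is also [theta h]. But [theta] fixes no generator of
    ['S_n.+1]. *)

Import GRing.Theory.
Local Open Scope ring_scope.

Section Slice.
Variables (F : fieldType) (U V : vectType F) (phi : {linear U -> F^o}).

(* The map [phi (x) id] from [U (x) V] to [V]. *)
Definition slice (t : 'M[F]_(\dim {:U}, \dim {:V})) : V :=
  \sum_i \sum_j (t i j * phi (vbasis fullv)`_i : F) *: (vbasis fullv)`_j.

Lemma slice_linear : linear slice.
Proof.
move=> k t t'; rewrite /slice scaler_sumr -big_split /=.
apply: eq_bigr => i _; rewrite scaler_sumr -big_split /=.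
by apply: eq_bigr => j _; rewrite !mxE mulrDl scalerDl -mulrA scalerA.
Qed.
HB.instance Definition _ := GRing.isLinear.Build F _ V _ slice slice_linear.

Lemma slice_tens (u : U) (v : V) : slice (tens u v) = (phi u : F) *: v.
Proof.
have -> : phi u =
    \sum_i coord (vbasis fullv) i u * phi (vbasis fullv)`_i :> F.
  rewrite [u in LHS](coord_vbasis (memvf u)) linear_sum.
  by apply: eq_bigr => i _; rewrite linearZ.
rewrite [in RHS](coord_vbasis (memvf v)) scaler_suml; apply: eq_bigr => i _.
rewrite scaler_sumr; apply: eq_bigr => j _.
by rewrite !mxE scalerA mulrAC.
Qed.

End Slice.
Arguments slice {F U V} phi t.

Section Evaluation.
Variables (F : fieldType) (gT : finGroupType) (h : gT).

Definition geval (a : galg F gT) : F^o := a h.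

Lemma geval_linear : linear geval.
Proof. by move=> k a b; rewrite /geval !ffunE. Qed.
HB.instance Definition _ := GRing.isLinear.Build F _ F^o _ geval geval_linear.

End Evaluation.
Arguments geval {F gT} h a.

Lemma gelt_inj (F : fieldType) (gT : finGroupType) :
  injective (gelt F : gT -> galg F gT).
Proof.
move=> g h /ffunP/(_ g)/eqP; rewrite !ffunE eqxx.
by case: (g =P h) => // _; rewrite oner_eq0.
Qed.

(** As [gcomul] is extended linearly from group elements, [L] matters only on their diagonal
    tensors. Below, [L] is a slice composed with a [tensmap]. *)
Lemma linear_gcomul (F : fieldType) (gT : finGroupType) (W : lmodType F)
    (L : {linear 'M[F]_(\dim {: galg F gT}, \dim {: galg F gT}) -> W})
    (a : galg F gT) :
  L (gcomul a) = \sum_g (a g : F) *: L (tens (gelt F g) (gelt F g)).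
Proof.
by rewrite /gcomul /gext linear_sum; apply: eq_bigr => g _; rewrite linearZ.
Qed.

(** In the first summand of [coaction] only the term of [h] survives. In the second the left leg of
    the term of [g] is [theta g]; as [theta] is an involution, only [g = theta h] survives, and its
    right leg is again [h]. *)
Lemma slice_coaction (F : fieldType) (n : nat) (h : 'S_n) (a : CS F n) :
  slice (geval h) (coaction a) =
  xi ((a h : F) *: gelt F h) + eta ((a (theta h) : F) *: gelt F h).
Proof.
rewrite /coaction linearD !linearZ; congr (_ + _).
  apply: etrans (linear_gcomul _ _ _
    (slice (geval h) \o tensmap idfun (@xi F n)) a) _ => /=.
  rewrite (bigD1 h) //= big1 => [|g /negPf gh]; rewrite tensmapE slice_tens /=.
    by rewrite /geval ffunE eqxx scale1r addr0.
  by rewrite /geval ffunE eq_sym gh scale0r scaler0.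
apply: etrans (linear_gcomul _ _ _ (slice (geval h) \o
  tensmap (@Theta F n) (@eta F n \o @Theta F n)) a) _ => /=.
rewrite (bigD1 (theta h)) //= big1 => [|g gh]; rewrite tensmapE slice_tens /=.
  by rewrite !Theta_gelt thetaK /geval ffunE eqxx scale1r addr0.
rewrite !Theta_gelt /geval ffunE -(inj_eq (inv_inj (@thetaK n))) thetaK.
by rewrite eq_sym (negPf gh) scale0r scaler0.
Qed.

(** Compare images of the point [i]: [transp i] raises it by one, and [transp k] does so only if
    [k = i]. *)
Lemma transp_inj (n : nat) : injective (@transp n).
Proof.
move=> i k /permP/(_ (Ordinal (ltnW (transp_subproof i)))).
rewrite /transp tpermL; case: tpermP => [[ik] _|[ik]|_ _].
- exact: val_inj.
- by move=> /(congr1 val) /=; lia.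
- by move=> /(congr1 val) /=; lia.
Qed.

(** The generators are pairwise distinct, so the value of [a] at [transp i] is exactly [c i]. *)
Lemma length_one_coef (F : fieldType) (n : nat) (a : CS F n) :
  length_one a -> exists i, a (transp i) != 0.
Proof.
case=> a_neq0 [c ac].
have [i ci] : exists i, c i != 0.
  apply/existsP; apply: contraNT a_neq0; rewrite negb_exists => /forallP c0.
  by rewrite ac big1 // => i _; have /negPn/eqP -> := c0 i; rewrite scale0r.
exists i; suff -> : a (transp i) = c i by [].
rewrite ac sum_ffunE (bigD1 i) //= big1 => [|k ki]; rewrite !ffunE.
  by rewrite eqxx addr0; apply: mulr1.
rewrite (inj_eq (@transp_inj n)) eq_sym (negPf ki); exact: mulr0.
Qed.

Theorem proposition5p1 (R : realType) (n : nat) (n_ge3 : (3 <= n)%N)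
    (n_even : ~~ odd n) :
  ~ exists chi : {linear CS R[i] n -> CS R[i] n.+1},
      (forall a, length_one a -> length_one (chi a)) /\
      exists zeta : {lrmorphism CG R[i] n -> CG R[i] n.+1},
        hopf_morphism zeta /\
        (forall a, coaction (chi a) = tensmap chi zeta (coaction a)).
Proof.
case=> chi [chi1 [zeta [_ chi_zeta]]].
(* Indices start from 0 and [rev_ord] sends [i] to [n - 2 - i]; for even [n] it fixes
   [n / 2 - 1]. *)
have mid_proof : (n./2.-1 < n.-1)%N by lia.
pose s := transp (Ordinal mid_proof).
have theta_s : theta s = s.
  by rewrite theta_transp; congr transp; apply: val_inj => /=; lia.
have s_length_one : length_one (gelt R[i] s).
  split; first by apply/eqP => /ffunP/(_ s)/eqP; rewrite !ffunE eqxx oner_eq0.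
  exists (fun i => (i == Ordinal mid_proof)%:R).
  rewrite (bigD1 (Ordinal mid_proof)) //= eqxx scale1r big1 ?addr0 //.
  by move=> i /negPf ->; rewrite scale0r.
set a := chi (gelt R[i] s).
have [i ai] := length_one_coef _ _ _ (chi1 _ s_length_one).
pose u := zeta (gelt R[i] s, gelt R[i] s).
(* [zeta] is multiplicative and unital, and [(s, s)] squares to the unit of the direct sum. *)
have uu : u * u = 1.
  have ss : gelt R[i] s * gelt R[i] s = 1 by rewrite -geltM tperm2.
  rewrite /u -rmorphM -[RHS](rmorph1 zeta); congr (zeta _).
  exact: (congr2 pair ss ss).
have coef_u h :
    ((a h : R[i]) *: gelt R[i] h, (a (theta h) : R[i]) *: gelt R[i] h) =
    (a h : R[i]) *: u.
  transitivity (slice (geval h) (coaction a)).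
    by rewrite slice_coaction; congr pair; rewrite /= ?addr0 ?add0r.
  (* Since [theta s = s], both terms have left leg [a], and their right legs add up to [u]. *)
  rewrite chi_zeta coaction_gelt theta_s !linearD /= !tensmapE !slice_tens.
  rewrite -scalerDr -linearD; congr (_ *: zeta _).
  by congr pair; rewrite /= ?addr0 ?add0r.
have u1 h : a h != 0 -> u.1 = gelt R[i] h.
  by move=> ah; have [/(scalerI ah) ->] := coef_u h.
have a_theta : a (theta (transp i)) != 0.
  (* If it vanished, the second components in [coef_u] would force [u.2 = 0], against
     [u.2 * u.2 = 1]. *)
  apply: contraTneq (oner_neq0 (CS R[i] n.+1)) => a0.
  have [_ /esym/eqP] := coef_u (transp i).
  rewrite a0 scale0r scaler_eq0 (negPf ai) /= => /eqP u2.
  by rewrite -(congr1 snd uu : u.2 * u.2 = 1) u2 mulr0 eqxx.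
have /gelt_inj : gelt R[i] (transp i) = gelt R[i] (transp (rev_ord i)).
  by rewrite -theta_transp -(u1 _ ai) -(u1 _ a_theta).
(* Here [rev_ord] sends [i] to [n - 1 - i], so a fixed index would give [n = 2 * i + 1], which is
   odd. *)
move=> /transp_inj /(congr1 val) /=; have := ltn_ord i => /=; lia.
Qed.
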